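(* For $\gamma,\beta,\alpha\in(0,\pi)$ the following hold. (i) If $\gamma+\beta<\pi$, then $c(2\gamma,\beta,\beta)=2b(\gamma,\beta)$. (ii) $b(\gamma,\pi-\gamma)=\frac12 a(2\gamma)$. (iii) If $\gamma+\beta+\alpha=\pi$ and $\alpha\le\beta$, then $2c(\gamma,\beta,\alpha)=2a(\gamma)+2k(2\alpha,\gamma,\gamma)$ and $2c(\gamma,\beta,\alpha)=a(2\alpha)+a(2\beta)+2k(\gamma,2\alpha,2\beta)$.
   Context: The functions are defined as follows. $a:(0,2\pi)\to\mathbb{R}$, $a(\gamma)=\frac1\pi+\left(1-\frac{\gamma}{\pi}\right)\cot\gamma$ for $\gamma\ne\pi$, and $a(\pi)=0$. For positive angles, $$b(\gamma,\beta)=\int_0^\infty \frac{\cosh(\frac{\pi}{2}\theta)\cosh((\gamma-\beta)\theta)-\cosh((\frac{\pi}{2}-\gamma-\beta)\theta)}{2\sinh((\gamma+\beta)\theta)\sinh(\frac{\pi}{2}\theta)}\,d\theta,$$ $$c(\gamma,\beta,\alpha)=b(\gamma+\beta,\alpha)+b(\gamma+\alpha,\beta)+\int_0^\infty\frac{\cosh(\frac{\pi}{2}\theta)\left[\cosh((\beta+\alpha)\theta)-\cosh((\beta-\alpha)\theta)\right]}{\sinh((\gamma+\beta+\alpha)\theta)\sinh(\frac{\pi}{2}\theta)}\,d\theta,$$ and $$k(\alpha,\theta,\sigma)=\frac1{2\pi}\big[-(\sigma+\theta+\alpha-\pi)\cot(\sigma+\theta+\alpha)-(\alpha-\pi)\cot\alpha+(\sigma+\alpha-\pi)\cot(\sigma+\alpha)+(\theta+\alpha-\pi)\cot(\theta+\alpha)\big]$$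 when $\sigma+\theta+\alpha\neq\pi$, $\alpha\ne\pi$, $\sigma+\alpha\neq\pi$, $\theta+\alpha\neq\pi$; in the remaining cases $k$ is defined by taking the appropriate limits (each term $(x-\pi)\cot x$ is replaced by its limit $1$ at $x=\pi$). *)

(* Defs.v *)
From HB Require Import structures.
From mathcomp Require Import all_boot all_order all_algebra.
From mathcomp Require Import all_classical all_reals all_analysis.

Set Implicit Arguments.
Unset Strict Implicit.
Unset Printing Implicit Defensive.

Import Order.TTheory GRing.Theory Num.Theory.
Import numFieldNormedType.Exports.

Local Open Scope classical_set_scope.
Local Open Scope ring_scope.

Section functions.
Context {R : realType}.
Implicit Types x g : R.

Definition cosh x : R := (expR x + expR (- x)) / 2.
Definition sinh x : R := (expR x - expR (- x)) / 2.
Definition cot x : R := cos x / sin x.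

(* Division is total, so the formula would give 1 / pi, not 0, at [pi]. *)
Definition afun g : R :=
  if g == pi then 0 else pi^-1 + (1 - g / pi) * cot g.

(* The integrands below are continuous on the open half-line, bounded near 0
   and exponentially small at infinity (for positive angles), so the Lebesgue
   integral coincides with the improper Riemann integral. *)
Definition bfun (gamma beta : R) : R :=
  \int[lebesgue_measure]_(theta in `]0, +oo[)
    ((cosh (pi / 2 * theta) * cosh ((gamma - beta) * theta)
       - cosh ((pi / 2 - gamma - beta) * theta))
     / (2 * sinh ((gamma + beta) * theta) * sinh (pi / 2 * theta))).

Definition cfun (gamma beta alpha : R) : R :=
  bfun (gamma + beta) alpha + bfun (gamma + alpha) beta
  + \int[lebesgue_measure]_(theta in `]0, +oo[)
      (cosh (pi / 2 * theta)
         * (cosh ((beta + alpha) * theta) - cosh ((beta - alpha) * theta))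
       / (sinh ((gamma + beta + alpha) * theta) * sinh (pi / 2 * theta))).

(* [(x - pi) * cot x], continuously extended at [pi]: since
   [cot (pi + h) = cot h], the limit of [h * cot h] at 0 is 1. *)
Definition shift_cot x : R := if x == pi then 1 else (x - pi) * cot x.

Definition kfun (alpha theta sigma : R) : R :=
  (2 * pi)^-1 *
    (- shift_cot (sigma + theta + alpha) - shift_cot alpha
     + shift_cot (sigma + alpha) + shift_cot (theta + alpha)).

End functions.

(* Main.v *)
Require Import Defs.
From HB Require Import structures.
From mathcomp Require Import all_boot all_order all_algebra.
From mathcomp Require Import all_classical all_reals all_analysis.
From mathcomp Require Import measurable_realfun.
From mathcomp Require Import ring lra.

(** All three parts come down to one integral: for [|a| < pi],
[[
  \int_0^oo (cosh (a x) - 1) / sinh (pi x / 2) ^ 2 dx = 2 / pi * (1 - a cot a),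
]]
    where [a cot a] stands for [1] at [a = 0] ([has_integral_csch]).  When
    [gamma + beta = pi], the denominator [2 sinh (pi x) sinh (pi x / 2)] in
    [bfun] equals [4 sinh (pi x / 2) ^ 2 cosh (pi x / 2)], so that [bfun] is a
    quarter of this integral at [a = gamma - beta]; when
    [gamma + beta + alpha = pi], the third integral in [cfun] is likewise half
    the difference of its values at [beta + alpha] and [beta - alpha].  Since
    [afun] and [kfun] are affine combinations of values of [shift_cot], the last
    two parts follow from the reflection [shift_cot (2 pi - x) = shift_cot x].
    The first part holds already between the integrands; only their separate
    integrability must be checked, and the addition formulas split the integrand
    of [bfun] into two pieces with visible exponential bounds.

    The integral is computed termwise, by monotone convergence, from
    [1 / sinh (x / 2) ^ 2 = 4 \sum_(n >= 1) n exp (- n x)].  The partial sums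
    of the resulting series are those of the partial fraction expansion of
    [a cot a].  That expansion comes from the following form of the argument of
    Herglotz.  On [(0, pi)], let [cot_rem N] be the difference between the
    cotangent and its [2 N] poles nearest to [pi / 2].  The duplication formula
    of the cotangent expresses [cot_rem (2 N) t] as the mean of [cot_rem N] at
    [t / 2] and [(t + pi) / 2], which halves Lipschitz constants; as [cot_rem 1]
    is [1]-Lipschitz, [cot_rem (2 ^ m)] is [2 ^ - m]-Lipschitz, and since it is
    odd about [pi / 2] it tends to [0]. *)

Import Order.TTheory GRing.Theory Num.Theory.
Import numFieldNormedType.Exports.

Set Implicit Arguments.
Unset Strict Implicit.
Unset Printing Implicit Defensive.

Local Open Scope classical_set_scope.
Local Open Scope ring_scope.

Section cotangent.
Context {R : realType}.
Implicit Types t x y g : R.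

(** * Partial fractions of the cotangent *)

(** Both bounds say that [sin t / t] is the value of [cos] at a point
    between [0] and [t]. *)
Lemma sin_bounds t : 0 < t <= pi / 2 -> t * cos t <= sin t <= t.
Proof.
move=> /andP[t0 tpi].
have [|c] := @MVT_segment R sin cos 0 t (ltW t0) _.
  by apply: continuous_subspaceT => x; exact: continuous_sin.
rewrite in_itv/= sin0 !subr0 => /andP[c0 ct] ->.
have pi0 : 0 < (pi : R) := pi_gt0 R.
have cosct : cos t <= cos c.
  move: ct; rewrite le_eqVlt => /orP[/eqP -> //|ct].
  by rewrite ltW// ltr_cos// in_itv/=; lra.
by rewrite [cos c * t]mulrC ler_pM2l// cosct ler_piMr ?cos_le1 ?ltW.
Qed.

Lemma cot_piB x : cot (pi - x) = - cot x.
Proof.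
rewrite /cot cosB sinB cospi sinpi.
by rewrite !mul0r mulN1r addr0 sub0r mulN1r opprK mulNr.
Qed.

Lemma is_derive_cot x : sin x != 0 -> is_derive x 1 cot (- (sin x ^+ 2)^-1).
Proof.
move=> s0; apply: is_derive_eq.
rewrite /GRing.scale/= -[in RHS](mulN1r _) -(cos2Dsin2 x); by field.
Qed.

(** The cotangent minus its [2 N] poles [- (N - 1) pi, ..., N pi].  This range
    is symmetric about [pi / 2]; the poles [- n pi] and [(n + 1) pi] are
    paired. *)
Definition cot_rem (N : nat) t : R :=
  cot t - \sum_(n < N) ((n%:R * pi + t)^-1 - (n.+1%:R * pi - t)^-1).

Lemma cot_rem_sym N t : cot_rem N (pi - t) = - cot_rem N t.
Proof.
rewrite /cot_rem cot_piB -opprD; congr (- (_ + _)).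
rewrite -sumrN; apply: eq_bigr => n _.
by rewrite [RHS]opprB -[n.+1]addn1 natrD; congr (_^-1 - _^-1); ring.
Qed.

Lemma cot_double x : sin x != 0 -> cos x != 0 ->
  cot x + cot (x + pi / 2) = 2 * cot (2 * x).
Proof.
move=> s0 c0; rewrite /cot sinDpihalf cosDpihalf [2 * x]mulr_natl.
rewrite sin_mulr2n cos_mulr2n.
have -> : cos x ^+ 2 *+ 2 - 1 = cos x ^+ 2 - sin x ^+ 2.
  by rewrite -(cos2Dsin2 x); ring.
by field; rewrite s0 c0.
Qed.

Lemma cot_rem_double N t : 0 < t < pi ->
  cot_rem N (t / 2) + cot_rem N ((t + pi) / 2) = 2 * cot_rem N.*2 t.
Proof.
move=> /andP[t0 tpi]; have pi0 : 0 < (pi : R) := pi_gt0 R.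
have -> : (t + pi) / 2 = t / 2 + pi / 2 by rewrite mulrDl.
have st : sin (t / 2) != 0 by rewrite gt_eqF// sin_gt0_pi//; lra.
have ct : cos (t / 2) != 0 by rewrite gt_eqF// cos_gt0_pihalf//; lra.
rewrite /cot_rem [2 * _]mulrBr [in X in 2 * X - _](_ : t = 2 * (t / 2));
  last by field.
rewrite -cot_double// addrACA -opprD; congr (_ - _).
elim: N => [|N ih]; first by rewrite !big_ord0 addr0 mulr0.
rewrite doubleS !big_ord_recr/= addrACA ih.
rewrite -addrA (mulrDr 2); congr (_ + _).
have N0 : 0 <= N%:R * pi :> R by rewrite mulr_ge0// ltW.
rewrite -!natr1 -muln2 natrM.
by field; do ?(apply/andP; split); apply/eqP; nra.
Qed.

(** The derivative of [cot_rem 1] is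
    [- 1 / sin t ^ 2 + 1 / t ^ 2 + 1 / (pi - t) ^ 2].  For [t <= pi / 2] the
    first two terms add up to a number between [- 1] and [0], by [sin_bounds],
    and the third lies between [0] and [1]; the case [t > pi / 2] follows by
    symmetry. *)
Lemma cot_rem1_lip x y : 0 < x < pi -> 0 < y < pi ->
  `|cot_rem 1 x - cot_rem 1 y| <= `|x - y|.
Proof.
wlog xy : x y / y <= x.
  move=> h hx hy; have [/h|/ltW /h] := leP y x; first exact.
  by move=> /(_ hy hx); rewrite distrC [in leRHS]distrC.
move=> /andP[x0 xpi] /andP[y0 ypi]; have pi0 : 0 < (pi : R) := pi_gt0 R.
have dD t : 0 < t < pi ->
    is_derive t 1 (cot_rem 1)
      (- (sin t ^+ 2)^-1 + (t ^+ 2)^-1 + ((pi - t) ^+ 2)^-1).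
  move=> /andP[t0 tpi].
  have -> : cot_rem 1 = (cot - (fun t => t^-1)) + (fun t => (pi - t)^-1).
    apply/funext => u; rewrite /cot_rem big_ord1 mul0r add0r mul1r.
    by rewrite opprB addrA addrAC.
  have := is_derive_cot (x := t).
  rewrite gt_eqF; last by rewrite sin_gt0_pi// t0.
  move=> /(_ isT) dc.
  have d2 : is_derive t 1 (fun t : R => t^-1) (- (t ^+ 2)^-1).
    have t0' : t != 0 by rewrite gt_eqF.
    apply: (is_derive_eq (is_deriveV (f := id) t0' _)).
    by rewrite /GRing.scale/=; field.
  have d3 : is_derive t 1 (fun t : R => (pi - t)^-1) ((pi - t) ^+ 2)^-1.
    have t0' : pi - t != 0 by rewrite gt_eqF// subr_gt0.
    have d : is_derive t 1 (fun t : R => pi - t) (0 - 1) by apply: is_deriveB.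
    apply: (is_derive_eq (is_deriveV (f := fun t : R => pi - t) t0' d)).
    by rewrite sub0r /GRing.scale/= mulrN1 opprK.
  by apply: is_derive_eq; rewrite opprK.
have half (u : R) : 0 < u <= pi / 2 -> -1 <= (u ^+ 2)^-1 - (sin u ^+ 2)^-1 <= 0.
  move=> hu; have /andP[su su'] := sin_bounds hu; have /andP[u0 upi] := hu.
  have s0 : 0 < sin u by rewrite sin_gt0_pi//; lra.
  have c0 : 0 <= cos u by rewrite cos_ge0_pihalf//; lra.
  have := cos2Dsin2 u.
  set s := sin u in su su' s0 *; set c := cos u in su c0 * => cs.
  have -> : (u ^+ 2)^-1 - (s ^+ 2)^-1 = (s ^+ 2 - u ^+ 2) / (u ^+ 2 * s ^+ 2).
    by field; rewrite !gt_eqF.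
  rewrite ler_pdivlMr ?ler_pdivrMr ?mulr_gt0 ?exprn_gt0//.
  have uc0 : 0 <= u * c by rewrite mulr_ge0// ltW.
  have us : (u * c) ^+ 2 <= s ^+ 2 by rewrite ler_sqr ?nnegrE// ltW.
  have su2 : s ^+ 2 <= u ^+ 2 by rewrite ler_sqr ?nnegrE// ltW.
  rewrite exprMn (_ : c ^+ 2 = 1 - s ^+ 2) in us; last by rewrite -cs addrK.
  by apply/andP; split; lra.
have inv1 (u : R) : 1 <= u -> 0 <= (u ^+ 2)^-1 <= 1.
  move=> u1.
  by rewrite invr_ge0 sqr_ge0 invf_le1 ?exprn_ege1// exprn_gt0//; lra.
have pih := @pihalf_ge1 R.
have bnd t : 0 < t < pi ->
    `|- (sin t ^+ 2)^-1 + (t ^+ 2)^-1 + ((pi - t) ^+ 2)^-1| <= 1.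
  move=> /andP[t0 tpi]; rewrite ler_norml; have [tp|tp] := leP t (pi / 2).
    have := half t; rewrite t0 tp => /(_ isT); have := inv1 (pi - t); lra.
  have := half (pi - t); have := inv1 t.
  rewrite sinB sinpi cospi mul0r mulN1r sub0r opprK; lra.
have in_pi z : z \in `]y, x[%R -> 0 < z < pi.
  by rewrite in_itv/= => /andP[? ?]; apply/andP; split; lra.
have cD : {within `[y, x], continuous (cot_rem 1)}.
  apply: derivable_within_continuous => z; rewrite in_itv/= => /andP[? ?].
  by have [|] := dD z; [lra|].
have dD' z : z \in `]y, x[%R -> is_derive z 1 (cot_rem 1) _ :=
  fun hz => dD z (in_pi z hz).
have [c] := MVT_segment xy dD' cD.
rewrite in_itv/= => /andP[? ?] ->; rewrite normrM ler_piMl// bnd//; lra.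
Qed.

(** Each doubling of the number of poles halves the Lipschitz constant. *)
Lemma cot_rem_lip m x y : 0 < x < pi -> 0 < y < pi ->
  `|cot_rem (2 ^ m) x - cot_rem (2 ^ m) y| <= `|x - y| / 2 ^+ m.
Proof.
have pi0 : 0 < (pi : R) := pi_gt0 R.
elim: m x y => [|m ih] x y hx hy; first by rewrite divr1; exact: cot_rem1_lip.
have dbl z : 0 < z < pi -> cot_rem (2 ^ m.+1) z =
    (cot_rem (2 ^ m) (z / 2) + cot_rem (2 ^ m) ((z + pi) / 2)) / 2.
  by move=> hz; rewrite cot_rem_double// expnS mul2n mulrC mulKf.
rewrite !dbl// -mulrBl opprD addrACA normrM (ger0_norm (x := 2^-1))//.
rewrite ler_pdivrMr//.
have /andP[x0 xpi] := hx; have /andP[y0 ypi] := hy.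
have hl : `|cot_rem (2 ^ m) (x / 2) - cot_rem (2 ^ m) (y / 2)|
    <= `|x / 2 - y / 2| / 2 ^+ m by apply: ih; lra.
have hr : `|cot_rem (2 ^ m) ((x + pi) / 2) - cot_rem (2 ^ m) ((y + pi) / 2)|
    <= `|(x + pi) / 2 - (y + pi) / 2| / 2 ^+ m by apply: ih; lra.
rewrite (le_trans (ler_normD _ _))// (le_trans (lerD hl hr))//.
have -> : (x + pi) / 2 - (y + pi) / 2 = x / 2 - y / 2 by field.
rewrite -mulrBl normrM (ger0_norm (x := 2^-1))// exprS.
by rewrite le_eqVlt; apply/orP; left; apply/eqP; field; rewrite expf_neq0.
Qed.

Lemma cot_rem_bound m t : 0 < t < pi -> `|cot_rem (2 ^ m) t| <= pi / 2 ^+ m.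
Proof.
move=> /[dup] ht /andP[t0 tpi].
(* [pi - t] is where [cot_rem] takes the opposite value. *)
have := @cot_rem_lip m t (pi - t) ht; rewrite cot_rem_sym opprK -mulr2n.
rewrite normrMn => h0; have {h0}h := h0 ltac:(lra).
rewrite (le_trans _ (le_trans h _))//; first by rewrite mulr2n lerDl.
rewrite ler_pM2r ?invr_gt0 ?exprn_gt0// ler_norml; lra.
Qed.

(** The partial fraction expansion of the cotangent, along powers of two. *)
Lemma cot_rem_cvg t : 0 < t < pi -> cot_rem (2 ^ m) t @[m --> \oo] --> (0 : R).
Proof.
move=> ht; apply/norm_cvg0P.
apply: (@squeeze_cvgr _ _ _ _ (fun=> 0) (fun m => pi * (2^-1) ^+ m)).
- by near=> m; rewrite normr_ge0 exprVn cot_rem_bound.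
- exact: cvg_cst.
- rewrite -[X in _ --> X](mulr0 (pi : R)); apply: cvgMr.
  by apply: cvg_expr; rewrite ger0_norm ?invf_lt1// ltr1n.
Unshelve. all: by end_near. Qed.

(** * The continuous extension of [(x - pi) cot x] *)

Lemma cotDpi x : cot (pi + x) = cot x.
Proof. by rewrite addrC /cot sinDpi cosDpi divrNN. Qed.

Lemma shift_cotDpi x : x != 0 -> shift_cot (pi + x) = x * cot x.
Proof.
have pxp : pi + x - pi = x by rewrite addrAC subrr add0r.
by move=> x0; rewrite /shift_cot -subr_eq0 pxp (negPf x0) cotDpi.
Qed.

Lemma shift_cot_refl x : shift_cot (2 * pi - x) = shift_cot x.
Proof.
rewrite /shift_cot; have -> : 2 * pi - x = pi + (pi - x) by ring.
have pxp : pi + (pi - x) - pi = - (x - pi) by ring.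
rewrite cotDpi cot_piB -subr_eq0 -[x == pi]subr_eq0 pxp oppr_eq0.
by case: ifP => // _; rewrite mulrNN.
Qed.

Lemma afunE g : afun g = (1 - shift_cot g) / pi.
Proof.
have p0 : pi != 0 :> R by rewrite gt_eqF// pi_gt0.
rewrite /afun /shift_cot; case: ifP => _; first by rewrite subrr mul0r.
(* [field] would unfold [pi]: it is abstracted, here and below. *)
by move: (pi : R) p0 => p p0; field.
Qed.

End cotangent.

Section hyperbolic.
Context {R : realType}.
Implicit Types x y p : R.

(** * Hyperbolic functions *)

Lemma coshN x : cosh (- x) = cosh x.
Proof. by rewrite /cosh opprK addrC. Qed.

Lemma cosh0 : cosh 0 = 1 :> R.
Proof. by rewrite /cosh oppr0 expR0 divff. Qed.

Lemma cosh_ge1 x : 1 <= cosh x.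
Proof.
rewrite /cosh expRN; have := expR_gt0 x; set e := expR x => e0.
have -> : (e + e^-1) / 2 = 1 + (e - 1) ^+ 2 / (2 * e) by field; rewrite gt_eqF.
by rewrite lerDl divr_ge0 ?sqr_ge0// mulr_ge0// ltW.
Qed.

Lemma sinh_half_sqr x :
  sinh (x / 2) ^+ 2 = (1 - expR (- x)) ^+ 2 / (4 * expR (- x)).
Proof.
rewrite /sinh; have -> : - x = - (x / 2) + - (x / 2) by field.
rewrite expRD expRN; have := expR_gt0 (x / 2) => e0.
by field; rewrite gt_eqF.
Qed.

Lemma sinhN x : sinh (- x) = - sinh x.
Proof. by rewrite /sinh opprK -mulNr opprB. Qed.

Lemma le_sinh x y : x <= y -> sinh x <= sinh y.
Proof.
by move=> xy; rewrite /sinh ler_pM2r// lerB// ler_expR// lerN2.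
Qed.

Lemma sinh0 : sinh 0 = 0 :> R.
Proof. by rewrite /sinh oppr0 subrr mul0r. Qed.

Lemma sinh_gt0 x : 0 < x -> 0 < sinh x.
Proof. by move=> x0; rewrite /sinh divr_gt0// subr_gt0 ltr_expR gtrN. Qed.

Lemma cosh_gt0 x : 0 < cosh x.
Proof. by rewrite (lt_le_trans _ (cosh_ge1 x)). Qed.

Lemma sinhD x y : sinh (x + y) = sinh x * cosh y + cosh x * sinh y.
Proof. by rewrite /sinh /cosh !opprD !expRD; field. Qed.

Lemma coshD x y : cosh (x + y) = cosh x * cosh y + sinh x * sinh y.
Proof. by rewrite /sinh /cosh !opprD !expRD; field. Qed.

Lemma cosh2_sinh2 x : cosh x ^+ 2 - sinh x ^+ 2 = 1.
Proof.
by rewrite /sinh /cosh expRN; field; rewrite gt_eqF// expR_gt0.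
Qed.

Lemma cosh_addE x y : cosh (x + y) = cosh (x - y) + 2 * sinh x * sinh y.
Proof. by rewrite !coshD coshN sinhN; ring. Qed.

Lemma sinh_double x : sinh (2 * x) = 2 * sinh x * cosh x.
Proof. by rewrite mulr_natl mulr2n sinhD; ring. Qed.

Lemma cosh_double x : cosh (2 * x) = 1 + 2 * sinh x ^+ 2.
Proof. by rewrite mulr_natl mulr2n coshD; have := cosh2_sinh2 x; lra. Qed.

Lemma coshV_le x : (cosh x)^-1 <= 2 * expR (- x).
Proof.
rewrite -[2 * _]invrK lef_pV2 ?posrE ?cosh_gt0 ?invr_gt0 ?mulr_gt0 ?expR_gt0//.
rewrite invfM -expRN opprK /cosh mulrC ler_pM2r//.
by rewrite lerDl expR_ge0.
Qed.

Lemma sinh_le_expR x : sinh x <= expR x.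
Proof. by rewrite /sinh; have := expR_ge0 x; have := expR_ge0 (- x); lra. Qed.

Lemma sinh_le_mul_expR x : sinh x <= x * expR x.
Proof.
have := expR_ge1Dx (- x + - x); rewrite expRD /sinh expRN.
have := expR_gt0 x; set e := expR x => e0 h.
rewrite ler_pdivrMr// -(ler_pM2l (x := e^-1)) ?invr_gt0//.
have -> : e^-1 * (x * e * 2) = 2 * x by field; rewrite gt_eqF.
by rewrite mulrBr mulVf ?gt_eqF//; lra.
Qed.

Lemma sinh_ge_mul_expR x : x * expR (- x) <= sinh x.
Proof. by have := sinh_le_mul_expR (- x); rewrite sinhN mulNr lerN2. Qed.

(** Multiplying a hyperbolic sine by the hyperbolic cotangent does not create
    more than exponential growth: the pole of the cotangent is cancelled. *)
Lemma coth_sinh_le x y : 0 < y -> 0 <= x ->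
  cosh y / sinh y * sinh x <= (1 + x / y) * expR x.
Proof.
move=> y0 x0; have sy := sinh_gt0 y0.
have -> : cosh y / sinh y = 1 + expR (- y) / sinh y.
  apply: (mulIf (lt0r_neq0 sy)); rewrite divfK ?gt_eqF// mulrDl divfK ?gt_eqF//.
  by rewrite mul1r /sinh /cosh; field.
rewrite !mulrDl !mul1r lerD ?sinh_le_expR//.
have hy : expR (- y) / sinh y <= y^-1.
  by rewrite ler_pdivrMr// ler_pdivlMl// sinh_ge_mul_expR.
have sx : 0 <= sinh x by rewrite -[0]sinh0 le_sinh.
apply: le_trans (ler_wpM2r sx hy) _.
by rewrite mulrAC [leRHS]mulrC ler_wpM2l ?invr_ge0 ?(ltW y0)// sinh_le_mul_expR.
Qed.

Lemma continuous_cosh : continuous (cosh : R -> R).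
Proof.
move=> x; rewrite /cosh.
apply: cvgMl; apply: cvgD; first exact: continuous_expR.
apply: continuous_comp; last exact: continuous_expR.
exact: continuousN.
Qed.

Lemma continuous_sinh : continuous (sinh : R -> R).
Proof.
move=> x; rewrite /sinh.
apply: cvgMl; apply: cvgB; first exact: continuous_expR.
apply: continuous_comp; last exact: continuous_expR.
exact: continuousN.
Qed.

Lemma continuous_coshM p : continuous (fun x => cosh (p * x)).
Proof.
move=> x; apply: continuous_comp; last exact: continuous_cosh.
exact: mulrl_continuous.
Qed.

Lemma continuous_sinhM p : continuous (fun x => sinh (p * x)).
Proof.
move=> x; apply: continuous_comp; last exact: continuous_sinh.
exact: mulrl_continuous.
Qed.

End hyperbolic.

Section half_line.
Context {R : realType}.
Implicit Types (f g : R -> R) (c v w x : R).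
Notation mu := (@lebesgue_measure R).

(** * Integrals over the half-line *)

(** [f] is Lebesgue integrable on the open half-line, with integral [v].  The
    integrability is part of the notion because the real-valued integral is
    additive only on integrable functions. *)
Definition has_integral f v :=
  mu.-integrable `]0, +oo[ (EFin \o f) /\ \int[mu]_(x in `]0, +oo[) f x = v.

Lemma has_integralD f g v w : has_integral f v -> has_integral g w ->
  has_integral (fun x => f x + g x) (v + w).
Proof.
move=> [fi <-] [gi <-]; split; last by rewrite RintegralD.
by apply: eq_integrable (integrableD _ fi gi).
Qed.

Lemma has_integralB f g v w : has_integral f v -> has_integral g w ->
  has_integral (fun x => f x - g x) (v - w).
Proof.
move=> [fi <-] [gi <-]; split; last by rewrite RintegralB.
by apply: eq_integrable (integrableB _ fi gi).
Qed.

Lemma has_integralZ f v c : has_integral f v ->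
  has_integral (fun x => c * f x) (c * v).
Proof.
move=> [fi <-]; split; last by rewrite RintegralZl.
by apply: eq_integrable (integrableZl _ c fi).
Qed.

Lemma eq_has_integral f g v : (forall x, 0 < x -> f x = g x) ->
  has_integral f v -> has_integral g v.
Proof.
move=> fg; have fgD : {in (`]0, +oo[%classic : set R), f =1 g}.
  by move=> x; rewrite inE/= in_itv/= andbT; exact: fg.
move=> [fi <-]; split; last by apply: eq_Rintegral => x xD; rewrite fgD.
by apply: eq_integrable fi => // x xD; rewrite /= fgD.
Qed.

Lemma has_integral_unique f v w : has_integral f v -> has_integral f w -> v = w.
Proof. by move=> [_ <-] [_ <-]. Qed.

Lemma has_integral_expR c : 0 < c ->
  has_integral (fun x => expR (- (c * x))) c^-1.
Proof.
move=> c0.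
have ce : continuous (fun x => expR (- (c * x))).
  move=> x; apply: continuous_comp; last exact: continuous_expR.
  by apply: continuousN; apply: mulrl_continuous.
have mE A : measurable_fun A (fun x => expR (- (c * x))).
  by apply: measurable_funTS; exact: continuous_measurable_fun.
have dE x : is_derive x 1 (fun x => - (c^-1 * expR (- (c * x))))
    (expR (- (c * x))).
  have dl : is_derive x 1 (fun x => - (c * x)) (- c).
    by apply: is_derive_eq; rewrite /GRing.scale/= mulr1.
  have de : is_derive x 1 (fun x => expR (- (c * x))) (expR (- (c * x)) * - c).
    by apply: is_derive1_comp.
  apply: is_derive_eq; rewrite /GRing.scale/=; field.
  by rewrite gt_eqF.
have eint : (\int[mu]_(x in `]0%R, +oo[) (expR (- (c * x)))%:E = (c^-1)%:E)%E.
  rewrite integral_itv_obnd_cbnd; last by apply/measurable_EFinP.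
  rewrite (ge0_continuous_FTC2y
    (F := fun x => - (c^-1 * expR (- (c * x)))) (l := 0)).
  - by rewrite mulr0 oppr0 expR0 mulr1 -EFinB sub0r opprK.
  - by move=> x _; exact: expR_ge0.
  - exact: continuous_subspaceT.
  - rewrite -[X in _ --> X]oppr0; apply: cvgN.
    rewrite -[X in _ --> X](mulr0 c^-1); apply: cvgMr.
    apply: (cvg_comp _ _ _ (@cvgr_expR R)).
    exact: gt0_cvgMry.
  - by move=> x _; have [] := dE x.
  - apply: cvg_at_right_filter; apply: cvgN; apply: cvgMr; exact: ce.
  - by move=> x _; rewrite derive1E; apply: derive_val.
split; last by rewrite /Rintegral eint.
apply/integrableP; split; first by apply/measurable_EFinP; exact: mE.
under eq_integral do rewrite /= ger0_norm ?expR_ge0//.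
by rewrite eint ltry.
Qed.

Lemma dominated_integrable f c K : 0 < c ->
  (forall x, 0 < x -> {for x, continuous f}) ->
  (forall x, 0 < x -> `|f x| <= K * expR (- (c * x))) ->
  mu.-integrable `]0, +oo[ (EFin \o f).
Proof.
move=> c0 cf fK.
have [ei _] := has_integralZ K (has_integral_expR c0).
apply: le_integrable ei => //.
  apply/measurable_EFinP; apply: open_continuous_measurable_fun => //.
  by move=> x; rewrite inE/= in_itv/= andbT; exact: cf.
move=> x; rewrite /= in_itv/= andbT lee_fin => x0.
by rewrite (le_trans (fK x x0))// ler_norm.
Qed.

(** Monotone convergence. *)
Lemma has_integral_cvg (g : nat -> R -> R) (u : nat -> R) f L :
  (forall n, has_integral (g n) (u n)) ->
  (forall n x, 0 < x -> 0 <= g n x) ->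
  (forall x, 0 < x -> {homo g ^~ x : m n / (m <= n)%N >-> m <= n}) ->
  (forall x, 0 < x -> g n x @[n --> \oo] --> f x) ->
  u n @[n --> \oo] --> L ->
  has_integral f L.
Proof.
move=> gu g0 gnd gf uL.
have inD x : (`]0, +oo[%classic : set R) x -> 0 < x.
  by rewrite /= in_itv/= andbT.
have mg n : measurable_fun (`]0, +oo[%classic : set R) (g n).
  by apply/measurable_EFinP; case: (gu n) => /measurable_int.
have mf : measurable_fun (`]0, +oo[%classic : set R) f.
  by apply: (measurable_fun_cvg mg) => x /inD; exact: gf.
have f0 x : 0 < x -> 0 <= f x.
  by move=> x0; apply: (cvgr_to_ge (gf x x0)); apply: nearW => n; exact: g0.
have fL : (\int[mu]_(x in `]0%R, +oo[) (f x)%:E = L%:E)%E.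
  have mg' n : measurable_fun (`]0, +oo[%classic : set R) (EFin \o g n).
    exact/measurable_EFinP.
  have intg n : (\int[mu]_(x in `]0%R, +oo[) (g n x)%:E = (u n)%:E)%E.
    have [gi <-] := gu n.
    by rewrite /Rintegral fineK//; exact: integrable_fin_num.
  have limg x : x \in (`]0, +oo[%classic : set R) ->
      (f x)%:E = limn (fun n => (g n x)%:E).
    rewrite inE => /inD x0; apply/esym/cvg_lim => //.
    by apply: cvg_EFin; [exact: nearW|exact: gf].
  transitivity (\int[mu]_(x in `]0%R, +oo[) limn (fun n => (g n x)%:E))%E.
    exact: eq_integral.
  rewrite (monotone_convergence mu _ mg')//.
  - apply/cvg_lim => //; under eq_cvg do rewrite intg.
    by apply: cvg_EFin; [exact: nearW|].
  - by move=> n x /inD x0; rewrite lee_fin g0.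
  - by move=> x /inD x0 m n mn; rewrite lee_fin gnd.
split; last by rewrite /Rintegral fL.
apply/integrableP; split; first by apply/measurable_EFinP; exact: mf.
suff -> : (\int[mu]_(x in `]0%R, +oo[) `|(EFin \o f) x| = L%:E)%E.
  by rewrite ltry.
rewrite -fL; apply: eq_integral => x.
by rewrite inE => /inD x0; rewrite /= ger0_norm ?f0.
Qed.

End half_line.

Section csch_integral.
Context {R : realType}.
Implicit Types (a q x : R).

(** * The integral of [(cosh (a x) - 1) / sinh (pi x / 2) ^ 2] *)

(** The [n]-th term, indexed from [0], of the expansion of
    [(cosh (a x) - 1) / sinh (pi x / 2) ^ 2] in powers of [exp (- pi x)],
    written as a combination of decaying exponentials when [|a| < pi]. *)
Definition csch_term a (n : nat) x : R :=
  n.+1%:R * (2 * expR (- ((n.+1%:R * pi - a) * x))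
             + 2 * expR (- ((n.+1%:R * pi + a) * x))
             - 4 * expR (- (n.+1%:R * pi * x))).

Lemma csch_termE a n x : csch_term a n x =
  4 * (cosh (a * x) - 1) * (n.+1%:R * expR (- (pi * x)) ^+ n.+1).
Proof.
rewrite /csch_term /cosh -expRM_natl.
have -> : - ((n.+1%:R * pi - a) * x) = n.+1%:R * - (pi * x) + a * x by ring.
have -> : - ((n.+1%:R * pi + a) * x) = n.+1%:R * - (pi * x) + - (a * x) by ring.
have -> : - (n.+1%:R * pi * x) = n.+1%:R * - (pi * x) by ring.
by rewrite !expRD; field.
Qed.

Lemma csch_term_ge0 a n x : 0 <= csch_term a n x.
Proof.
rewrite csch_termE !mulr_ge0 ?subr_ge0 ?cosh_ge1 ?exprn_ge0 ?expR_ge0//.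
Qed.

(** The partial sums integrate to those of the partial fraction expansion of
    [a cot a]: the series has one pole [- N pi] more than [cot_rem N], whence
    the last term. *)
Lemma has_integral_csch_sum a N : 0 < a < pi ->
  has_integral (fun x => \sum_(n < N) csch_term a n x)
    (2 / pi * (1 - a * cot a + a * cot_rem N a - a / (N%:R * pi + a))).
Proof.
move=> /andP[a0 api]; have pi0 : 0 < (pi : R) := pi_gt0 R.
elim: N => [|N ih].
  rewrite mul0r add0r divff ?gt_eqF// /cot_rem big_ord0 subr0 subrK subrr mulr0.
  have := has_integralZ 0 (has_integral_expR (ltr01 : 0 < 1 :> R)).
  rewrite mul0r.
  by apply: eq_has_integral => x _; rewrite big_ord0 mul0r.
have N0 : 0 <= N%:R * pi :> R by rewrite mulr_ge0// ltW.
have N1 : N.+1%:R * pi = N%:R * pi + pi :> R by rewrite -natr1 mulrDl mul1r.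
have h1 : 0 < N.+1%:R * pi - a by lra.
have h2 : 0 < N.+1%:R * pi + a by lra.
have h3 : 0 < N.+1%:R * pi :> R by lra.
have := has_integralZ N.+1%:R (has_integralB (has_integralD
   (has_integralZ 2 (has_integral_expR h1))
   (has_integralZ 2 (has_integral_expR h2)))
   (has_integralZ 4 (has_integral_expR h3))).
move=> /(has_integralD ih) h.
rewrite (_ : 2 / pi * _ =
  2 / pi * (1 - a * cot a + a * cot_rem N a - a / (N%:R * pi + a)) +
  N.+1%:R * (2 / (N.+1%:R * pi - a) + 2 / (N.+1%:R * pi + a)
             - 4 / (N.+1%:R * pi))).
  by apply: eq_has_integral h => x _; rewrite big_ord_recr.
rewrite /cot_rem big_ord_recr/=; set S := \sum_(i < N) _.
rewrite N1 -natr1; field.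
by apply/and5P; split; apply/eqP; nra.
Qed.

Lemma sum_natmul_expr q N : (1 - q) ^+ 2 * (\sum_(n < N) n.+1%:R * q ^+ n.+1) =
  q * (1 - q ^+ N - N%:R * q ^+ N * (1 - q)).
Proof.
elim: N => [|N ih]; first by rewrite big_ord0 expr0; ring.
by rewrite big_ord_recr/= mulrDr ih -!natr1 !exprS; ring.
Qed.

Lemma cvg_pow2_natmul_expR x : 0 < x ->
  (2 ^ m)%:R * expR (- x) ^+ (2 ^ m) @[m --> \oo] --> (0 : R).
Proof.
move=> x0.
apply: (@squeeze_cvgr _ _ _ _ (fun=> 0) (fun m => 2 / x ^+ 2 * (2^-1) ^+ m)).
- near=> m; rewrite mulr_ge0 ?exprn_ge0 ?expR_ge0//=.
  rewrite -expRM_natl mulrN expRN exprVn -natrX.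
  set N : R := (2 ^ m)%:R; have N0 : 0 < N by rewrite ltr0n expn_gt0.
  have Nx : 0 < N * x by rewrite mulr_gt0.
  (* [exp (N x) >= (N x) ^ 2 / 2] beats the factor [N]. *)
  have := expR_ge1Dxn 1 (ltW Nx); rewrite (_ : 2`! = 2)%N// => h.
  have h' : (N * x) ^+ 2 / 2 <= expR (N * x) by lra.
  have Nx2 : 0 < (N * x) ^+ 2 / 2 by rewrite divr_gt0// exprn_gt0.
  have -> : 2 / x ^+ 2 / N = N * ((N * x) ^+ 2 / 2)^-1.
    by field; rewrite !gt_eqF.
  by rewrite ler_pM2l// lef_pV2// posrE expR_gt0.
- exact: cvg_cst.
- rewrite -[X in _ --> X](mulr0 (2 / x ^+ 2)); apply: cvgMr.
  by apply: cvg_expr; rewrite ger0_norm ?invf_lt1// ltr1n.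
Unshelve. all: by end_near. Qed.

Lemma csch_sum_cvg a x : 0 < x ->
  \sum_(n < 2 ^ m) csch_term a n x @[m --> \oo] -->
    (cosh (a * x) - 1) / sinh (pi / 2 * x) ^+ 2.
Proof.
move=> x0; have pi0 : 0 < (pi : R) := pi_gt0 R.
have px : 0 < pi * x by rewrite mulr_gt0.
have -> : pi / 2 * x = (pi * x) / 2 by rewrite mulrAC.
rewrite sinh_half_sqr; set q := expR (- (pi * x)).
have q0 : 0 < q by exact: expR_gt0.
have q1 : q < 1 by rewrite expR_lt1 oppr_lt0.
pose C := 4 * (cosh (a * x) - 1) * q / (1 - q) ^+ 2.
have -> : (cosh (a * x) - 1) / ((1 - q) ^+ 2 / (4 * q))
    = C * (1 - 0 - 0 * (1 - q)).
  by rewrite /C; field; rewrite subr_eq0 !gt_eqF.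
rewrite (_ : (fun m => _) = fun m =>
    C * (1 - q ^+ (2 ^ m) - (2 ^ m)%:R * q ^+ (2 ^ m) * (1 - q))).
  apply: cvgMr; apply: cvgB; last first.
    apply: cvgMl; exact: cvg_pow2_natmul_expR.
  apply: cvgB; first exact: cvg_cst.
  apply: (@squeeze_cvgr _ _ _ _ (fun=> 0) (fun m => (2 ^ m)%:R * q ^+ (2 ^ m))).
  - near=> m; apply/andP; split; first by rewrite exprn_ge0// ltW.
    apply: ler_peMl; first by rewrite exprn_ge0// ltW.
    by rewrite ler1n expn_gt0.
  - exact: cvg_cst.
  - exact: cvg_pow2_natmul_expR.
apply/funext => m; under eq_bigr do rewrite csch_termE.
rewrite -mulr_sumr -/q.
set S := \sum_(i < _) _; have := sum_natmul_expr q (2 ^ m); rewrite -/S => h.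
rewrite /C -[RHS]mulrA.
have q1' : 1 - q != 0 by rewrite subr_eq0 gt_eqF.
apply: (mulfI (expf_neq0 2 q1')); rewrite mulrCA h.
by field.
Unshelve. all: by end_near. Qed.

Lemma has_integral_csch_pos a : 0 < a < pi ->
  has_integral (fun x => (cosh (a * x) - 1) / sinh (pi / 2 * x) ^+ 2)
    (2 / pi * (1 - a * cot a)).
Proof.
move=> ha; have /andP[a0 api] := ha; have pi0 : 0 < (pi : R) := pi_gt0 R.
apply: (has_integral_cvg (fun m => has_integral_csch_sum (2 ^ m) ha)).
- by move=> m x _; apply: sumr_ge0 => n _; exact: csch_term_ge0.
- move=> x _ m n mn; rewrite -!(big_mkord xpredT (fun i => csch_term a i x)).
  rewrite (big_cat_nat (leq0n _) (leq_pexp2l _ mn))//= lerDl.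
  by apply: sumr_ge0 => i _; exact: csch_term_ge0.
- by move=> x; exact: csch_sum_cvg.
- apply: cvgMr; rewrite -[X in _ --> X]subr0; apply: cvgB.
    rewrite -[X in _ --> X]addr0 -(mulr0 a); apply: cvgD; first exact: cvg_cst.
    by apply: cvgMr; exact: cot_rem_cvg.
  apply: (@squeeze_cvgr _ _ _ _ (fun=> 0) (fun m => a / pi * (2^-1) ^+ m)).
  + near=> m; have N0 : 0 < (2 ^ m)%:R :> R by rewrite ltr0n expn_gt0.
    have Np : 0 < (2 ^ m)%:R * pi :> R by rewrite mulr_gt0.
    apply/andP; split; first by rewrite divr_ge0 ?addr_ge0 ?ltW.
    rewrite exprVn -natrX -mulrA ler_pM2l// -invfM.
    by rewrite lef_pV2 ?posrE ?addr_gt0 ?mulr_gt0// [pi * _]mulrC lerDl ltW.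
  + exact: cvg_cst.
  + rewrite -[X in _ --> X](mulr0 (a / pi)); apply: cvgMr.
    by apply: cvg_expr; rewrite ger0_norm ?invf_lt1// ltr1n.
Unshelve. all: by end_near. Qed.

Lemma has_integral_csch a : - pi < a < pi ->
  has_integral (fun x => (cosh (a * x) - 1) / sinh (pi / 2 * x) ^+ 2)
    (2 / pi * (1 - shift_cot (pi + a))).
Proof.
move=> /andP[aNpi api]; have [a0|a0|->] := ltgtP a 0.
- have -> : shift_cot (pi + a) = - a * cot (- a).
    rewrite -shift_cotDpi ?oppr_eq0 ?lt_eqF// -[LHS]shift_cot_refl.
    by congr shift_cot; ring.
  apply: eq_has_integral (has_integral_csch_pos (a := - a) _) => [x _|].
    by rewrite mulNr coshN.
  by apply/andP; split; lra.
- rewrite shift_cotDpi ?gt_eqF//; apply: has_integral_csch_pos; lra.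
- rewrite addr0 /shift_cot eqxx subrr mulr0.
  have := has_integralZ 0 (has_integral_expR (ltr01 : 0 < 1 :> R)).
  rewrite mul0r.
  by apply: eq_has_integral => x _; rewrite !mul0r cosh0 subrr mul0r.
Qed.

End csch_integral.

Section closed_forms.
Context {R : realType}.
Implicit Types (g b a p s x : R).
Notation mu := (@lebesgue_measure R).

(** * Integrability of the integrands of [bfun] and [cfun] *)

(** With [u = |p| x / 2], [v = s x / 2] and [y = pi x / 2], the integrand is
    [coth y sinh u * (sinh u / sinh v) / cosh v], which is at most a multiple of
    [exp (u - v)]. *)
Lemma integrable_coth_cosh p s : `|p| < s ->
  mu.-integrable `]0, +oo[ (EFin \o (fun x =>
    cosh (pi / 2 * x) * (cosh (p * x) - 1)
      / (sinh (s * x) * sinh (pi / 2 * x)))).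
Proof.
move=> ps; have pi0 : 0 < (pi : R) := pi_gt0 R.
have p0 := normr_ge0 p; have s0 : 0 < s := le_lt_trans p0 ps.
have c0 : 0 < (s - `|p|) / 2 by lra.
apply: (dominated_integrable (K := 2 * (1 + `|p| / pi)) c0) => x x0.
  apply: cvgM.
    apply: cvgM; first exact: continuous_coshM.
    by apply: cvgB; [exact: continuous_coshM|exact: cvg_cst].
  apply: cvgV; first by rewrite mulf_neq0// gt_eqF// sinh_gt0// mulr_gt0//; lra.
  by apply: cvgM; exact: continuous_sinhM.
pose y := pi / 2 * x; pose u := `|p| / 2 * x; pose v := s / 2 * x.
have y0 : 0 < y by rewrite mulr_gt0//; lra.
have v0 : 0 < v by rewrite mulr_gt0//; lra.
have u0 : 0 <= u by rewrite mulr_ge0//; lra.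
have uv : u <= v by rewrite ler_wpM2r//; lra.
have -> : s * x = 2 * v by rewrite /v; field.
have -> : cosh (p * x) = cosh (2 * u).
  have -> : 2 * u = `|p| * x by rewrite /u; field.
  by have [_|_] := ger0P p; rewrite // mulNr coshN.
rewrite -/y sinh_double cosh_double.
have sy := sinh_gt0 y0; have sv := sinh_gt0 v0; have cv := cosh_gt0 v.
have su : 0 <= sinh u by rewrite -[0]sinh0 le_sinh.
have suv := le_sinh uv.
have -> : cosh y * (1 + 2 * sinh u ^+ 2 - 1) / (2 * sinh v * cosh v * sinh y) =
   (cosh y / sinh y * sinh u) * (sinh u / sinh v) * (cosh v)^-1.
  by field; rewrite !gt_eqF.
have h0 : 0 <= cosh y / sinh y * sinh u.
  by rewrite mulr_ge0// divr_ge0// ltW// cosh_gt0.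
have r0 : 0 <= sinh u / sinh v by rewrite divr_ge0// ltW.
have r1 : sinh u / sinh v <= 1 by rewrite ler_pdivrMr// mul1r.
have cv' : 0 <= (cosh v)^-1 by rewrite invr_ge0 ltW.
rewrite ger0_norm; last by rewrite mulr_ge0// mulr_ge0.
have hux := coth_sinh_le y0 u0.
have -> : 2 * (1 + `|p| / pi) * expR (- ((s - `|p|) / 2 * x)) =
   (1 + u / y) * expR u * (2 * expR (- v)).
  have -> : - ((s - `|p|) / 2 * x) = u - v by rewrite /u /v; field.
  have -> : u / y = `|p| / pi.
    by rewrite /u /y; move: (pi : R) pi0 => P P0; field; rewrite !gt_eqF.
  by rewrite expRD; ring.
apply: ler_pM; [by rewrite mulr_ge0|by rewrite invr_ge0 ltW| |exact: coshV_le].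
by apply: le_trans hux; rewrite ler_piMr.
Qed.

(** Here [|pi / 2 - s| < pi / 2], so the integrand is at most
    [1 / cosh (s x)] in absolute value. *)
Lemma integrable_sinh_ratio s : 0 < s < pi ->
  mu.-integrable `]0, +oo[ (EFin \o (fun x =>
    sinh ((pi / 2 - s) * x) / (cosh (s * x) * sinh (pi / 2 * x)))).
Proof.
move=> /andP[s0 spi]; have pi0 : 0 < (pi : R) := pi_gt0 R.
apply: (dominated_integrable (K := 2) s0) => x x0.
  apply: cvgM; first exact: continuous_sinhM.
  apply: cvgV.
    by rewrite mulf_neq0// gt_eqF ?cosh_gt0// sinh_gt0// mulr_gt0//; lra.
  by apply: cvgM; [exact: continuous_coshM|exact: continuous_sinhM].
have S0 : 0 < sinh (pi / 2 * x) by rewrite sinh_gt0// mulr_gt0//; lra.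
have c0 := cosh_gt0 (s * x).
rewrite normrM normfV (gtr0_norm (mulr_gt0 c0 S0)).
rewrite invfM mulrCA mulrC.
apply: le_trans (coshV_le (s * x)); rewrite ler_piMl ?invr_ge0 ?(ltW c0)//.
rewrite ler_pdivrMr// mul1r ler_norml -sinhN -mulNr.
by rewrite !le_sinh// (ler_pM2r x0); lra.
Qed.

(** The integrand is half the sum of the two integrands above, for
    [p = g - b] and [s = g + b] in the first and [s = (g + b) / 2] in the
    second. *)
Lemma integrable_bfun g b : 0 < g -> 0 < b -> g + b < 2 * pi ->
  mu.-integrable `]0, +oo[ (EFin \o (fun x =>
    (cosh (pi / 2 * x) * cosh ((g - b) * x) - cosh ((pi / 2 - g - b) * x))
     / (2 * sinh ((g + b) * x) * sinh (pi / 2 * x)))).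
Proof.
move=> g0 b0 gb; have pi0 : 0 < (pi : R) := pi_gt0 R.
have h1 : `|g - b| < g + b by rewrite ltr_norml; apply/andP; split; lra.
have h2 : 0 < (g + b) / 2 < pi by apply/andP; split; lra.
have i1 := integrable_coth_cosh h1; have i2 := integrable_sinh_ratio h2.
have [/= i _] := has_integralZ 2^-1
  (has_integralD (conj i1 erefl) (conj i2 erefl)).
apply: (eq_integrable _ _ _ _ i) => // x.
rewrite inE /= in_itv/= andbT => x0; congr EFin.
set s := (g + b) / 2 * x; set y := pi / 2 * x.
have -> : (pi / 2 - g - b) * x = (y - s) - s by rewrite /s /y; field.
have -> : (g + b) * x = 2 * s by rewrite /s; field.
have -> : (pi / 2 - (g + b) / 2) * x = y - s by rewrite /s /y; field.
have -> : cosh (y - s - s) = cosh y - 2 * sinh (y - s) * sinh s.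
  by have := cosh_addE (y - s) s; rewrite subrK => ->; rewrite addrK.
have s0 : 0 < s by rewrite mulr_gt0//; lra.
have y0 : 0 < y by rewrite mulr_gt0//; lra.
have := sinh_gt0 s0; have := cosh_gt0 s; have := sinh_gt0 y0 => *.
by rewrite sinh_double; field; rewrite !gt_eqF.
Qed.

(** * Values of [bfun] and [cfun] *)

Lemma cfun_double g b : 0 < g -> 0 < b -> g + b < pi ->
  cfun (2 * g) b b = 2 * bfun g b.
Proof.
move=> g0 b0 gb; have pi0 : 0 < (pi : R) := pi_gt0 R.
have i1 : 0 < 2 * g + b by lra.
have i2 : 2 * g + b + b < 2 * pi by lra.
have i3 : g + b < 2 * pi by lra.
have i4 : `|b + b| < 2 * g + b + b by rewrite ltr_norml; apply/andP; split; lra.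
have hb : has_integral _ (bfun (2 * g + b) b) :=
  conj (integrable_bfun i1 b0 i2) erefl.
have hg : has_integral _ (bfun g b) := conj (integrable_bfun g0 b0 i3) erefl.
pose f x := cosh (pi / 2 * x) * (cosh ((b + b) * x) - cosh ((b - b) * x))
  / (sinh ((2 * g + b + b) * x) * sinh (pi / 2 * x)).
have fE x : 0 < x -> cosh (pi / 2 * x) * (cosh ((b + b) * x) - 1)
    / (sinh ((2 * g + b + b) * x) * sinh (pi / 2 * x)) = f x.
  by rewrite /f subrr mul0r cosh0.
have [fi _] := eq_has_integral fE (conj (integrable_coth_cosh i4) erefl).
have h := has_integralD (has_integralD hb hb)
  (conj fi erefl : has_integral f _).
apply: (has_integral_unique _ (has_integralZ 2 hg)).
apply: eq_has_integral h => x x0; rewrite /f subrr mul0r cosh0.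
set y := pi / 2 * x; set s := (g + b) * x; set d := (g - b) * x.
have -> : (2 * g + b - b) * x = s + d by rewrite /s /d; ring.
have -> : (b + b) * x = s - d by rewrite /s /d; ring.
have -> : (2 * g + b + b) * x = 2 * s by rewrite /s; ring.
have -> : (pi / 2 - (2 * g + b) - b) * x = (y - s) - s by rewrite /s /y; ring.
have -> : (pi / 2 - g - b) * x = y - s by rewrite /s /y; ring.
have y0 : 0 < y by rewrite mulr_gt0//; lra.
have s0 : 0 < s by rewrite mulr_gt0//; lra.
have -> : cosh (y - s - s) = 2 * cosh (y - s) * cosh s - cosh y.
  have := coshD (y - s) s; have := coshD (y - s) (- s).
  by rewrite subrK coshN sinhN; lra.
have -> : cosh (s + d) = 2 * cosh s * cosh d - cosh (s - d).
  by rewrite !coshD coshN sinhN; ring.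
rewrite sinh_double.
have := sinh_gt0 s0; have := cosh_gt0 s; have := sinh_gt0 y0 => *.
by field; rewrite !gt_eqF.
Qed.

Lemma bfun_supplementary g b : 0 < g -> 0 < b -> g + b = pi ->
  bfun g b = (1 - shift_cot (2 * g)) / (2 * pi).
Proof.
move=> g0 b0 gb; have pi0 : 0 < (pi : R) := pi_gt0 R.
have gb' : - pi < g - b < pi by apply/andP; split; lra.
have := has_integralZ 4^-1 (has_integral_csch gb').
have -> : pi + (g - b) = 2 * g by rewrite -gb; ring.
have -> : 4^-1 * (2 / pi * (1 - shift_cot (2 * g)))
    = (1 - shift_cot (2 * g)) / (2 * pi).
  by move: (pi : R) pi0 => P P0; field; rewrite gt_eqF.
move=> h; suff [_] : has_integral (fun x =>
    (cosh (pi / 2 * x) * cosh ((g - b) * x) - cosh ((pi / 2 - g - b) * x))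
     / (2 * sinh ((g + b) * x) * sinh (pi / 2 * x)))
    ((1 - shift_cot (2 * g)) / (2 * pi)) by [].
apply: eq_has_integral h => x x0.
set y := pi / 2 * x.
have -> : (pi / 2 - g - b) * x = - y by rewrite /y -gb; field.
have -> : (g + b) * x = 2 * y by rewrite /y gb; field.
have y0 : 0 < y by rewrite mulr_gt0//; lra.
have := sinh_gt0 y0; have := cosh_gt0 y; rewrite coshN sinh_double => *.
by field; rewrite !gt_eqF.
Qed.

Lemma cfun_supplementary g b a : 0 < g -> 0 < b -> 0 < a -> g + b + a = pi ->
  cfun g b a = (1 - shift_cot (2 * a)) / (2 * pi)
    + (1 - shift_cot (2 * b)) / (2 * pi)
    + (shift_cot (pi + (b - a)) - shift_cot (pi + (b + a))) / pi.
Proof.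
move=> g0 b0 a0 gba; have pi0 : 0 < (pi : R) := pi_gt0 R.
have h1 : - pi < b + a < pi by apply/andP; split; lra.
have h2 : - pi < b - a < pi by apply/andP; split; lra.
rewrite /cfun; congr (_ + _ + _).
- rewrite bfun_supplementary//; last by lra.
  rewrite -(shift_cot_refl (2 * (g + b))); congr ((1 - shift_cot _) / _).
  by rewrite -gba; ring.
- rewrite bfun_supplementary//; [|lra|lra].
  rewrite -(shift_cot_refl (2 * (g + a))); congr ((1 - shift_cot _) / _).
  by rewrite -gba; ring.
have := has_integralZ 2^-1
  (has_integralB (has_integral_csch h1) (has_integral_csch h2)).
move=> h; suff [_ ->] : has_integral (fun x =>
    (cosh (pi / 2 * x) * (cosh ((b + a) * x) - cosh ((b - a) * x)) /
      (sinh ((g + b + a) * x) * sinh (pi / 2 * x))))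
    (2^-1 * (2 / pi * (1 - shift_cot (pi + (b + a)))
             - 2 / pi * (1 - shift_cot (pi + (b - a))))).
  by move: (pi : R) pi0 => P P0; field; rewrite gt_eqF.
apply: eq_has_integral h => x x0.
set y := pi / 2 * x.
have -> : (g + b + a) * x = 2 * y by rewrite /y gba; field.
have y0 : 0 < y by rewrite mulr_gt0//; lra.
have := sinh_gt0 y0; have := cosh_gt0 y; rewrite sinh_double => *.
by field; rewrite !gt_eqF.
Qed.

End closed_forms.

Theorem proposition1p3 (R : realType) (gamma beta alpha : R)
    (hgamma : 0 < gamma < pi) (hbeta : 0 < beta < pi) (halpha : 0 < alpha < pi) :
  [/\ gamma + beta < pi -> cfun (2 * gamma) beta beta = 2 * bfun gamma beta,
      bfun gamma (pi - gamma) = 2^-1 * afun (2 * gamma) &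
      gamma + beta + alpha = pi -> alpha <= beta ->
        2 * cfun gamma beta alpha
          = 2 * afun gamma + 2 * kfun (2 * alpha) gamma gamma /\
        2 * cfun gamma beta alpha
          = afun (2 * alpha) + afun (2 * beta)
            + 2 * kfun gamma (2 * alpha) (2 * beta)].
Proof.
have pi0 : 0 < (pi : R) := pi_gt0 R.
have [/andP[g0 gpi] /andP[b0 bpi] /andP[a0 api]] := And3 hgamma hbeta halpha.
split; first exact: cfun_double.
  rewrite bfun_supplementary ?subr_gt0//; last by rewrite addrC subrK.
  by rewrite afunE; move: (pi : R) pi0 => P P0; field; rewrite gt_eqF.
move=> gba _; rewrite cfun_supplementary// !afunE /kfun.
have -> : shift_cot gamma = shift_cot (pi + (beta + alpha)).
  by rewrite -[LHS]shift_cot_refl -gba; congr shift_cot; ring.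
have -> : shift_cot (gamma + gamma + 2 * alpha) = shift_cot (2 * beta).
  by rewrite -[LHS]shift_cot_refl -gba; congr shift_cot; ring.
have -> : gamma + 2 * alpha = 2 * alpha + gamma by rewrite addrC.
have -> : shift_cot (2 * alpha + gamma) = shift_cot (pi + (beta - alpha)).
  by rewrite -[LHS]shift_cot_refl -gba; congr shift_cot; ring.
have -> : 2 * beta + 2 * alpha + gamma = pi + (beta + alpha).
  by rewrite -gba; ring.
have -> : 2 * beta + gamma = pi + (beta - alpha) by rewrite -gba; ring.
by move: (pi : R) pi0 => P P0; split; field; rewrite gt_eqF.
Qed.
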